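(* $\alpha$-equivalence of finite bar strings is decidable in polynomial time: there is a polynomial-time algorithm that, given two bar strings $v,w\in\overline{\mathbb A}^*$, decides whether $v\equiv_\alpha w$.
   Context: $\mathbb A$ is a fixed countably infinite set of names; $\overline{\mathbb A}=\mathbb A\cup\{\vert a : a\in\mathbb A\}$, where $a$ is a plain name and $\vert a$ a bar name. A bar string is a finite word over $\overline{\mathbb A}$. Finite permutations $\pi$ of $\mathbb A$ act by $\pi\cdot a=\pi(a)$, $\pi\cdot\vert a=\vert\pi(a)$, and letterwise on words; $(a\ c)$ is the transposition of $a$ and $c$. For bar strings $v,u$ write $\langle a\rangle v=\langle b\rangle u$ iff $(a\ c)\cdot v=(b\ c)\cdot u$ for some (equivalently every) name $c\notin\{a,b\}$ not occurring (plain or barred) in $v$ or $u$. $\alpha$-equivalence $\equiv_\alpha$ on bar strings is the equivalence relation generated by $w\vert a\,v\equiv_\alpha w\vert b\,u$ whenever $\langle a\rangle v=\langle b\rangle u$. *)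

(* Defs.v *)
From HB Require Import structures.
From mathcomp Require Import all_boot all_algebra.
From Stdlib Require Import Relation_Operators.

Set Implicit Arguments.
Unset Strict Implicit.
Unset Printing Implicit Defensive.

(** ** Bar strings and alpha-equivalence *)

Inductive letter (A : Type) : Type := Plain of A | Bar of A.

Definition barstring (A : Type) : Type := seq (letter A).

Definition map_letter (A B : Type) (f : A -> B) (x : letter A) : letter B :=
  match x with Plain a => Plain (f a) | Bar a => Bar (f a) end.

Definition letter_name (A : Type) (x : letter A) : A :=
  match x with Plain a => a | Bar a => a end.

(** The names occurring in a bar string, plain or barred. *)
Definition names (A : Type) (v : barstring A) : seq A :=
  map (@letter_name A) v.

Definition transp (A : eqType) (a c x : A) : A :=
  if x == a then c else if x == c then a else x.

Definition swap (A : eqType) (a c : A) (v : barstring A) : barstring A :=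
  map (map_letter (transp a c)) v.

(** [abs_eq a v b u] is the equality of name abstractions <a>v = <b>u. *)
Definition abs_eq (A : eqType) (a : A) (v : barstring A) (b : A)
    (u : barstring A) : Prop :=
  exists c : A,
    [/\ c != a, c != b, c \notin names v, c \notin names u
      & swap a c v = swap b c u].

Inductive alpha_step (A : eqType) : barstring A -> barstring A -> Prop :=
  AlphaStep (w : barstring A) (a : A) (v : barstring A) (b : A)
      (u : barstring A) :
    abs_eq a v b u -> alpha_step (w ++ Bar a :: v) (w ++ Bar b :: u).

Definition alpha_eq (A : eqType) : barstring A -> barstring A -> Prop :=
  clos_refl_sym_trans (barstring A) (@alpha_step A).

(** ** Deterministic multi-tape Turing machines *)

Inductive move : Type := MoveLeft | Stay | MoveRight.

(** A tape is infinite in both directions; [None] is the blank symbol, cells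
    outside the stored lists are blank, and [left_part] lists the cells to the
    left of the head from the nearest to the farthest. *)
Record tape (G : Type) : Type := Tape {
  left_part : seq (option G);
  scanned : option G;
  right_part : seq (option G)
}.

Definition write (G : Type) (s : option G) (t : tape G) : tape G :=
  Tape (left_part t) s (right_part t).

Definition move_head (G : Type) (m : move) (t : tape G) : tape G :=
  match m with
  | MoveLeft =>
      Tape (behead (left_part t)) (head None (left_part t))
           (scanned t :: right_part t)
  | Stay => t
  | MoveRight =>
      Tape (scanned t :: left_part t) (head None (right_part t))
           (behead (right_part t))
  end.

(** The head scans the first symbol of the word. *)
Definition tape_of (G : Type) (s : seq G) : tape G :=
  Tape [::] (head None (map some s)) (behead (map some s)).

(** The tape alphabet consists of the blank, the input alphabet [Sigma] and the
    working symbols [work].  There is at least one tape.  [verdict q] is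
    [Some true] for accepting states, [Some false] for rejecting states and
    [None] for states in which the machine goes on. *)
Record machine (Sigma : finType) : Type := Machine {
  state : finType;
  work : finType;
  ntapes' : nat;
  start : state;
  verdict : state -> option bool;
  trans : state -> {ffun 'I_ntapes'.+1 -> option (Sigma + work)} ->
          state * {ffun 'I_ntapes'.+1 -> option (Sigma + work) * move}
}.

Section Runs.
Variables (Sigma : finType) (M : machine Sigma).

Definition symbol : Type := (Sigma + work M)%type.

Record config : Type := Config {
  cur_state : state M;
  tapes : 'I_(ntapes' M).+1 -> tape symbol
}.

(** The input is on tape 0, the other tapes are blank. *)
Definition init (x : seq Sigma) : config :=
  Config (start M)
         (fun i => if i == ord0 then tape_of (map inl x) else tape_of [::]).

(** A configuration with a verdict is halted: it no longer changes. *)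
Definition step (k : config) : config :=
  if verdict (cur_state k) is Some _ then k
  else
    let r := trans (cur_state k) [ffun i => scanned (tapes k i)] in
    Config r.1 (fun i => move_head (r.2 i).2 (write (r.2 i).1 (tapes k i))).

Definition answer_after (n : nat) (x : seq Sigma) : option bool :=
  verdict (cur_state (iter n step (init x))).

End Runs.

(** The property [P] of the objects [x : X], presented to the machine as the
    words [enc x], is decided by one machine within a number of steps that is
    polynomial in the length of [enc x]. *)
Definition polytime_decidable (Sigma : finType) (X : Type)
    (enc : X -> seq Sigma) (P : X -> Prop) : Prop :=
  exists (M : machine Sigma) (p : {poly nat}),
    forall x : X, exists (n : nat) (b : bool),
      [/\ (n <= p.[size (enc x)]%R)%N, answer_after M n (enc x) = Some b
        & b <-> P x].

(** ** Pairs of bar strings as input words *)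

Inductive insym : Type := Bit of bool | PlainMark | BarMark | Separator.

Definition insym_code (s : insym) : bool + option bool :=
  match s with
  | Bit b => inl b
  | PlainMark => inr (Some false)
  | BarMark => inr (Some true)
  | Separator => inr None
  end.

Definition insym_decode (s : bool + option bool) : insym :=
  match s with
  | inl b => Bit b
  | inr (Some false) => PlainMark
  | inr (Some true) => BarMark
  | inr None => Separator
  end.

Lemma insym_codeK : cancel insym_code insym_decode.
Proof. by case. Qed.

HB.instance Definition _ := Finite.copy insym (can_type insym_codeK).

(** [code] writes names as bit strings.  The mark in front of each name says
    whether the letter is plain or barred, and ends the preceding name. *)
Definition enc_letter (A : Type) (code : A -> seq bool) (x : letter A) :
    seq insym :=
  match x with
  | Plain a => PlainMark :: map Bit (code a)
  | Bar a => BarMark :: map Bit (code a)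
  end.

Definition enc_barstring (A : Type) (code : A -> seq bool) (v : barstring A) :
    seq insym :=
  flatten (map (enc_letter code) v).

Definition enc_pair (A : Type) (code : A -> seq bool)
    (vw : barstring A * barstring A) : seq insym :=
  enc_barstring code vw.1 ++ Separator :: enc_barstring code vw.2.

(* Main.v *)
(** Two bar strings are alpha-equivalent iff they have the same de Bruijn form:
    every step of alpha-equivalence preserves it, and conversely binders can be
    renamed one by one, from left to right, to common fresh names.  Hence both
    strings can be read in parallel, pushing the names of bar letters on two
    stacks.  A pair of plain letters is accepted iff the topmost stack level
    that holds one of the two names holds both, or, if there is no such level,
    the names are equal.

    A Turing machine with four tapes does this with nested linear scans.  Its
    program consists of instructions that run once over a word, and the running
    time is obtained by counting instructions. *)

From HB Require Import structures.
From mathcomp Require Import all_boot all_algebra zify.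
From Stdlib Require Import Relation_Operators.
Require Import Defs.

Set Implicit Arguments.
Unset Strict Implicit.
Unset Printing Implicit Defensive.

(** * Alpha-equivalence and de Bruijn indices *)

Definition db_name (A : eqType) (e : seq A) (a : A) : nat + A :=
  if a \in e then inl (index a e) else inr a.

(** A bar letter binds up to the end of the string, so the stack [e] of binder names, innermost
    first, only grows. *)
Fixpoint debruijn (A : eqType) (e : seq A) (v : barstring A) :
    seq (option (nat + A)) :=
  match v with
  | [::] => [::]
  | Plain a :: v' => Some (db_name e a) :: debruijn e v'
  | Bar a :: v' => None :: debruijn (a :: e) v'
  end.

(** Index 0 arises exactly from a match with the top; passing the top otherwise shifts indices by
    one, which is injective. *)
Lemma db_name_cons_eq (A : eqType) (e1 e2 : seq A) (c d a b : A) :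
  db_name (c :: e1) a = db_name (d :: e2) b <->
  (if (c == a) == (d == b) then c == a \/ db_name e1 a = db_name e2 b
   else False).
Proof.
rewrite /db_name !inE /= [a == c]eq_sym [b == d]eq_sym.
case: (c == a); case: (d == b) => //=; first by split=> // _; left.
- by case: (b \in e2).
- by case: (a \in e1).
by case: (a \in e1); case: (b \in e2); split=> [eq_ab|[//|eq_ab]]; try right;
  case: eq_ab => // ->.
Qed.

(** The assumption survives a push: by injectivity [f y] meets the new top [f a] exactly when [g y]
    meets [g a]. *)
Lemma debruijn_rename (A : eqType) (f g : A -> A) (e1 e2 : seq A)
    (x : barstring A) :
  injective f -> injective g ->
  {in names x, forall y, db_name e1 (f y) = db_name e2 (g y)} ->
  debruijn e1 (map (map_letter f) x) = debruijn e2 (map (map_letter g) x).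
Proof.
move=> f_inj g_inj; elim: x e1 e2 => [|[a|a] x IHx] e1 e2 //= e12.
  rewrite e12 ?inE ?eqxx // (IHx e1 e2) // => y yx.
  by apply: e12; rewrite inE yx orbT.
rewrite (IHx (f a :: e1) (g a :: e2)) // => y yx.
apply/db_name_cons_eq; rewrite (inj_eq f_inj) (inj_eq g_inj) eqxx; right.
by apply: e12; rewrite inE yx orbT.
Qed.

Lemma debruijn_cat_Bar (A : eqType) (w v u : barstring A) (a b : A)
    (l : seq A) :
  (forall l', debruijn (a :: l') v = debruijn (b :: l') u) ->
  debruijn l (w ++ Bar a :: v) = debruijn l (w ++ Bar b :: u).
Proof.
by move=> vu; elim: w l => [|[c|c] w IHw] l /=; rewrite ?vu ?IHw.
Qed.

(** * Invariance of the de Bruijn form under alpha-steps *)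

Lemma transpK (A : eqType) (a c : A) : involutive (transp a c).
Proof.
rewrite /transp => x; have [->|xa] := eqVneq x a.
  by rewrite eqxx; case: eqVneq.
have [->|xc] := eqVneq x c; first by rewrite eqxx.
by rewrite (negPf xa) (negPf xc).
Qed.

Lemma map_letter_id (A : Type) (f : A -> A) (v : barstring A) :
  f =1 id -> map (map_letter f) v = v.
Proof. by move=> fE; elim: v => [|[a|a] v /= ->] //=; rewrite fE. Qed.

Lemma swapK (A : eqType) (a c : A) : involutive (swap a c).
Proof.
move=> v; rewrite /swap -map_comp -[RHS](map_letter_id v (transpK a c)).
by apply: eq_map => -[].
Qed.

Lemma names_swap (A : eqType) (a c : A) (v : barstring A) :
  names (swap a c v) = map (transp a c) (names v).
Proof. by rewrite /names /swap -!map_comp; apply: eq_map => -[]. Qed.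

Lemma mem_names_swap (A : eqType) (a c : A) (v : barstring A) :
  (a \in names (swap a c v)) = (c \in names v).
Proof.
have {1}-> : a = transp a c c by rewrite /transp eqxx; case: eqVneq.
by rewrite names_swap mem_map //; apply: inv_inj (transpK a c).
Qed.

(** Both tails are transposed copies of one string [x] containing neither [a] nor [b]. The
    transpositions send [c] to the respective binders and fix every other name of [x]. *)
Lemma alpha_step_debruijn (A : eqType) (v w : barstring A) (l : seq A) :
  alpha_step v w -> debruijn l v = debruijn l w.
Proof.
case=> {v w} w a v b u [c [ca cb cv cu vu]].
apply: debruijn_cat_Bar => l'; set x := swap a c v in vu.
have -> : v = swap a c x by rewrite swapK.
have -> : u = swap b c x by rewrite vu swapK.
apply: debruijn_rename; try exact: inv_inj (transpK _ _).
move=> y yx; have ya : y != a.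
  by apply: contraNneq cv => ya; rewrite -(mem_names_swap a) -/x -ya.
have yb : y != b.
  by apply: contraNneq cu => yb; rewrite -(mem_names_swap b) -vu -yb.
apply/db_name_cons_eq; rewrite /transp (negPf ya) (negPf yb).
have [_|yc] := eqVneq y c; first by rewrite !eqxx; left.
by rewrite [a == y]eq_sym [b == y]eq_sym (negPf ya) (negPf yb) eqxx; right.
Qed.

Lemma alpha_eq_catl (A : eqType) (w v u : barstring A) :
  alpha_eq v u -> alpha_eq (w ++ v) (w ++ u).
Proof.
elim=> [_ _ [w' a x b y xy]|x|x y _ IH|x y z _ IH1 _ IH2].
- by apply: rst_step; rewrite !catA; constructor.
- exact: rst_refl.
- exact: rst_sym.
- exact: rst_trans IH1 IH2.
Qed.

(** The stacks being equally long, names resolve to the bottom [c] on both sides or on neither;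
    without the bottom both become the free name [c]. *)
Lemma debruijn_rcons (A : eqType) (e1 e2 : seq A) (c : A) (v w : barstring A) :
  size e1 = size e2 ->
  debruijn (rcons e1 c) v = debruijn (rcons e2 c) w ->
  debruijn e1 v = debruijn e2 w.
Proof.
elim: v w e1 e2 => [|[a|a] v IHv] [|[b|b] w] e1 e2 //= se.
  case=> ab /(IHv _ _ _ se) ->; congr (Some _ :: _).
  elim: e1 e2 se ab {IHv} => [|c1 e1 IHe] [|c2 e2] //=.
    move=> _; rewrite db_name_cons_eq;
    have [<-|_] := eqVneq c a; have [<-|_] := eqVneq c b => //=.
    by case.
  move=> [se]; rewrite !db_name_cons_eq; case: ifP => // _ [->|]; first by left.
  by move/(IHe _ se); right.
by case; rewrite -!rcons_cons => /IHv -> //=; rewrite se.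
Qed.

(** * Completeness of the de Bruijn form over infinitely many names *)

Section Fresh.
Variable A : eqType.
Hypothesis A_infinite : forall s : seq A, exists a : A, a \notin s.

(** One step suffices: a name [d] fresh for both sides witnesses the equality of abstractions, which
    is then checked letter by letter. *)
Lemma alpha_eq_rename_Bar (a c : A) (v : barstring A) :
  c != a -> c \notin names v ->
  alpha_eq (Bar a :: v) (Bar c :: swap a c v).
Proof.
move=> ca cv; apply: rst_step; apply: (@AlphaStep _ [::]).
have [d] := A_infinite (a :: c :: names v ++ names (swap a c v)).
rewrite !inE !mem_cat !negb_or => /and4P[da dc dv dv']; exists d; split=> //.
rewrite /swap -map_comp; elim: v cv dv {dv'} => //= x v IHv.
rewrite !inE !negb_or => /andP[cx cv] /andP[dx dv].
congr (_ :: _); last exact: IHv.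
by case: x cx dx => y /=; rewrite /transp => cy dy;
  case: (eqVneq y a) => [_|ya]; rewrite ?eqxx // 1?[y == c]eq_sym (negPf cy);
  rewrite 1?[y == d]eq_sym 1?(negPf dy) 1?[y == c]eq_sym ?(negPf cy).
Qed.

Lemma debruijn_swap (a c : A) (v : barstring A) :
  c \notin names v -> debruijn [:: c] (swap a c v) = debruijn [:: a] v.
Proof.
move=> cv; rewrite -[in RHS](@map_letter_id _ id v) //.
apply: debruijn_rename => //; first exact: inv_inj (transpK a c).
move=> y yv; have yc : y != c by apply: contraNneq cv => <-.
apply/db_name_cons_eq; rewrite /transp (negPf yc) [a == y]eq_sym.
have [->|ya] := eqVneq y a; first by rewrite !eqxx; left.
by rewrite [c == y]eq_sym (negPf yc); right.
Qed.

Lemma alpha_eq_debruijn (v w : barstring A) :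
  alpha_eq v w <-> debruijn [::] v = debruijn [::] w.
Proof.
split=> [|].
  by elim=> [x y /alpha_step_debruijn||x y _ ->|x y z _ -> _ ->].
(* Induction on the length, since the tails are renamed before the induction hypothesis is
   applied. *)
have [n] := ubnP (size v); elim: n v w => // n IHn [|[a|a] v] [|[b|b] w] //=.
- by move=> _ _; apply: rst_refl.
- rewrite ltnS => sv [<- vw]; apply: (@alpha_eq_catl _ [:: Plain a]).
  exact: IHn.
rewrite ltnS => sv [vw].
have [c] := A_infinite (a :: b :: names v ++ names w).
rewrite !inE !mem_cat !negb_or => /and4P[ca cb cv cw].
apply: rst_trans (alpha_eq_rename_Bar ca cv) _.
apply: rst_trans (rst_sym _ _ _ _ (alpha_eq_rename_Bar cb cw)).
apply: (@alpha_eq_catl _ [:: Bar c]); apply: IHn; first by rewrite size_map.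
by apply: (@debruijn_rcons _ [::] [::] c) => //; rewrite !debruijn_swap.
Qed.

End Fresh.

(** * A parallel check with a stack of binder pairs *)

Fixpoint same_binder (A : eqType) (e : seq (A * A)) (a b : A) : bool :=
  if e is (c, d) :: e' then
    if (c == a) == (d == b) then (c == a) || same_binder e' a b else false
  else a == b.

Fixpoint alpha_check (A : eqType) (e : seq (A * A)) (v w : barstring A) :
    bool :=
  match v, w with
  | [::], [::] => true
  | Plain a :: v', Plain b :: w' => same_binder e a b && alpha_check e v' w'
  | Bar a :: v', Bar b :: w' => alpha_check ((a, b) :: e) v' w'
  | _, _ => false
  end.

Lemma same_binderP (A : eqType) (e : seq (A * A)) (a b : A) :
  same_binder e a b <-> db_name (unzip1 e) a = db_name (unzip2 e) b.
Proof.
elim: e => [|[c d] e IHe] /=.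
  by split=> [/eqP ->//|[->]].
rewrite db_name_cons_eq; case: ifP => // _.
by split=> [/orP[|/IHe]|[->//|/IHe ->]]; rewrite ?orbT; [left|right|].
Qed.

Lemma alpha_checkP (A : eqType) (e : seq (A * A)) (v w : barstring A) :
  alpha_check e v w <-> debruijn (unzip1 e) v = debruijn (unzip2 e) w.
Proof.
elim: v w e => [|[a|a] v IHv] [|[b|b] w] e //=.
  split=> [/andP[/same_binderP -> /IHv -> //]|[ab /IHv ->]].
  by rewrite andbT; apply/same_binderP.
by rewrite (IHv w ((a, b) :: e)) /=; split=> [->|[]].
Qed.

(** The check only compares names, so it may be run on their injective codes. *)
Lemma alpha_check_map (A B : eqType) (f : A -> B) (e : seq (A * A))
    (v w : barstring A) : injective f ->
  alpha_check [seq (f x.1, f x.2) | x <- e] (map (map_letter f) v)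
    (map (map_letter f) w) = alpha_check e v w.
Proof.
move=> f_inj; have fE := inj_eq f_inj.
elim: v w e => [|[a|a] v IHv] [|[b|b] w] e //=;
  last exact: (IHv _ ((a, b) :: e)).
rewrite IHv; congr (_ && _).
by elim: e => [|[c d] e IHe] /=; rewrite !fE // IHe.
Qed.

(** * A four-tape program *)

(** A tape is named by two bits: the first tells whether it holds an
    environment (the stack of bar names read so far) or a word, the second
    whether it belongs to [v] or to [w]. *)
Definition tape_id : Type := (bool * bool)%type.

Notation word_w := (false, false).
Notation word_v := (false, true).
Notation env_w := (true, false).
Notation env_v := (true, true).

Definition cell : Type := option insym.

Definition tapes4 : Type :=
  ((tape insym * tape insym) * (tape insym * tape insym))%type.

Definition get_tape (T : tapes4) (i : tape_id) : tape insym :=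
  let p := if i.1 then T.2 else T.1 in if i.2 then p.2 else p.1.

Definition put_tape (T : tapes4) (i : tape_id) (t : tape insym) : tapes4 :=
  let put p := if i.2 then (p.1, t) else (t, p.2) in
  if i.1 then (T.1, put T.2) else (put T.1, T.2).

(** Here [None] leaves the scanned symbol as it is; blanks are never written. *)
Definition action : Type := (cell * move)%type.

Definition act (a : action) (t : tape insym) : tape insym :=
  move_head a.2 (if a.1 is Some s then write (Some s) t else t).

Definition act_all (a : tape_id -> action) (T : tapes4) : tapes4 :=
  ((act (a word_w) T.1.1, act (a word_v) T.1.2),
   (act (a env_w) T.2.1, act (a env_v) T.2.2)).

Definition stay : action := (None, Stay).
Definition go (m : move) : action := (None, m).
Definition put_symbol (s : insym) (m : move) : action := (Some s, m).

Definition is_bit (s : cell) : bool :=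
  if s is Some (Bit _) then true else false.
Definition is_separator (s : cell) : bool :=
  if s is Some Separator then true else false.

Inductive label : Type :=
  Init | CopyV | EndV | SkipW | EndW | RewindW | RewindV | Enter
| NextLetter | PushMark | PushV | PushW
| PopMark | FindV | FindW | AtMark
| EnterNames | CompareV | CompareWSame | CompareWDiff
| Unread | UnreadW | UnreadV | UnreadEnvV | UnreadEnvW
| EnterFree | CompareFree | TopV | TopW
| Accept | Reject.

Definition labels : seq label :=
  [:: Init; CopyV; EndV; SkipW; EndW; RewindW; RewindV; Enter;
      NextLetter; PushMark; PushV; PushW;
      PopMark; FindV; FindW; AtMark;
      EnterNames; CompareV; CompareWSame; CompareWDiff;
      Unread; UnreadW; UnreadV; UnreadEnvV; UnreadEnvW;
      EnterFree; CompareFree; TopV; TopW;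
      Accept; Reject].

Definition label_code (q : label) : nat :=
  match q with
  | Init => 0 | CopyV => 1 | EndV => 2 | SkipW => 3 | EndW => 4
  | RewindW => 5 | RewindV => 6 | Enter => 7
  | NextLetter => 8 | PushMark => 9 | PushV => 10 | PushW => 11
  | PopMark => 12 | FindV => 13 | FindW => 14 | AtMark => 15
  | EnterNames => 16 | CompareV => 17 | CompareWSame => 18 | CompareWDiff => 19
  | Unread => 20 | UnreadW => 21 | UnreadV => 22
  | UnreadEnvV => 23 | UnreadEnvW => 24
  | EnterFree => 25 | CompareFree => 26 | TopV => 27 | TopW => 28
  | Accept => 29 | Reject => 30
  end.

Lemma label_codeK : pcancel label_code (onth labels).
Proof. by case. Qed.

HB.instance Definition _ := Countable.copy label (pcan_type label_codeK).

Lemma labels_enum : Finite.axiom labels.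
Proof. by case. Qed.

HB.instance Definition _ := isFinite.Build label labels_enum.

(** [Scan], [Transfer] and [Compare] are loops that keep their label until they end. The first two
    run while their predicate holds; [Compare] goes to its first label on equal names and to its
    second otherwise. *)
Inductive instr : Type :=
| Halt of bool
| Do of (tape_id -> action) & label
| Branch of ((tape_id -> cell) -> label)
| Scan of tape_id & move & pred cell & label
| Transfer of tape_id & tape_id & pred cell & label
| Compare of tape_id & tape_id & label & label.

(** [Init] to [Enter] put each word between separators on its own tape and a separator at the bottom
    of each environment. For plain letters, [PopMark] to [AtMark] descend one level, [Unread] to
    [UnreadEnvW] return to the marks of a level that matches neither name, and [TopV], [TopW] return
    to the tops after success. Both stacks have equal height, so [env_v] alone tells when the bottom
    is reached. *)
Definition instr_at (q : label) : instr :=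
  match q with
  | Init => Do (fun i => if i is word_w then stay
                         else put_symbol Separator MoveRight) CopyV
  | CopyV => Transfer word_w word_v (predC is_separator) EndV
  | EndV => Do (fun i => match i with
                         | word_w => go MoveRight
                         | word_v => put_symbol Separator MoveLeft
                         | _ => stay
                         end) SkipW
  | SkipW => Scan word_w MoveRight isSome EndW
  | EndW => Do (fun i => if i is word_w then put_symbol Separator MoveLeft
                         else stay) RewindW
  | RewindW => Scan word_w MoveLeft (predC is_separator) RewindV
  | RewindV => Scan word_v MoveLeft (predC is_separator) Enter
  | Enter => Do (fun i => if i.1 then stay else go MoveRight) NextLetter
  | NextLetter => Branch (fun s =>
      match s word_v, s word_w with
      | Some Separator, Some Separator => Accept
      | Some PlainMark, Some PlainMark => PopMark
      | Some BarMark, Some BarMark => PushMark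
      | _, _ => Reject
      end)
  | PushMark => Do (fun i => if i.1 then put_symbol BarMark MoveRight
                             else go MoveRight) PushV
  | PushV => Transfer word_v env_v is_bit PushW
  | PushW => Transfer word_w env_w is_bit NextLetter
  | PopMark => Do (fun i => if i.1 then go MoveLeft else stay) FindV
  | FindV => Scan env_v MoveLeft is_bit FindW
  | FindW => Scan env_w MoveLeft is_bit AtMark
  | AtMark => Branch (fun s => if is_separator (s env_v) then EnterFree
                               else EnterNames)
  | EnterNames => Do (fun _ => go MoveRight) CompareV
  | CompareV => Compare word_v env_v CompareWSame CompareWDiff
  | CompareWSame => Compare word_w env_w TopV Reject
  | CompareWDiff => Compare word_w env_w Reject Unread
  | Unread => Do (fun _ => go MoveLeft) UnreadW
  | UnreadW => Scan word_w MoveLeft is_bit UnreadV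
  | UnreadV => Scan word_v MoveLeft is_bit UnreadEnvV
  | UnreadEnvV => Scan env_v MoveLeft is_bit UnreadEnvW
  | UnreadEnvW => Scan env_w MoveLeft is_bit PopMark
  | EnterFree => Do (fun i => if i.1 then stay else go MoveRight) CompareFree
  | CompareFree => Compare word_v word_w TopV Reject
  | TopV => Scan env_v MoveRight isSome TopW
  | TopW => Scan env_w MoveRight isSome NextLetter
  | Accept => Halt true
  | Reject => Halt false
  end.

Definition delta (q : label) (s : tape_id -> cell) :
    label * (tape_id -> action) :=
  match instr_at q with
  | Halt _ => (q, fun _ => stay)
  | Do a q' => (q', a)
  | Branch f => (f s, fun _ => stay)
  | Scan i m p q' =>
      if p (s i) then (q, fun k => if k == i then go m else stay)
      else (q', fun _ => stay)
  | Transfer i j p q' =>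
      if p (s i) then
        (q, fun k => if k == i then go MoveRight
                     else if k == j then (s i, MoveRight) else stay)
      else (q', fun _ => stay)
  | Compare i j same diff =>
      if is_bit (s i) && (s i == s j) then
        (q, fun k => if k == i then go MoveRight
                     else if k == j then go MoveRight else stay)
      else (if is_bit (s i) || is_bit (s j) then diff else same,
            fun _ => stay)
  end.

Definition answer (q : label) : option bool :=
  if instr_at q is Halt b then Some b else None.

Definition state4 : Type := (label * tapes4)%type.

Definition step4 (c : state4) : state4 :=
  let r := delta c.1 (fun i => scanned (get_tape c.2 i)) in
  (r.1, act_all r.2 c.2).

(** * Running the program *)

(** The head scans the first of the cells [r]; the cells [l] are listed from
    the nearest to the farthest. *)
Definition at_cells (l r : seq cell) : tape insym :=
  Tape l (head None r) (behead r).

(** For empty [r] the move would leave a stored blank to the right of the head, and the two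
    representations would differ. *)
Lemma move_left_cells (l r : seq cell) (x : cell) :
  r != [::] -> move_head MoveLeft (at_cells (x :: l) r) = at_cells l (x :: r).
Proof. by case: r. Qed.

Lemma get_put (T : tapes4) (i : tape_id) (t : tape insym) :
  get_tape (put_tape T i t) i = t.
Proof. by case: T i => -[? ?] [? ?] [[] []]. Qed.

Lemma get_put_neq (T : tapes4) (i j : tape_id) (t : tape insym) :
  i != j -> get_tape (put_tape T i t) j = get_tape T j.
Proof. by case: T i j => -[? ?] [? ?] [[] []] [[] []]. Qed.

Lemma put_put (T : tapes4) (i : tape_id) (t t' : tape insym) :
  put_tape (put_tape T i t) i t' = put_tape T i t'.
Proof. by case: T i => -[? ?] [? ?] [[] []]. Qed.

Lemma put_put_neq (T : tapes4) (i j : tape_id) (t t' : tape insym) :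
  i != j ->
  put_tape (put_tape T i t) j t' = put_tape (put_tape T j t') i t.
Proof. by case: T i j => -[? ?] [? ?] [[] []] [[] []]. Qed.

Lemma act_all_stay (T : tapes4) : act_all (fun=> stay) T = T.
Proof. by case: T => -[? ?] [? ?]. Qed.

Lemma put_get (T : tapes4) (i : tape_id) : put_tape T i (get_tape T i) = T.
Proof. by case: T i => -[? ?] [? ?] [[] []]. Qed.

Lemma act_all1 (T : tapes4) (i : tape_id) (a : action) :
  act_all (fun k => if k == i then a else stay) T =
  put_tape T i (act a (get_tape T i)).
Proof. by case: T i => -[? ?] [? ?] [[] []]. Qed.

Lemma act_all2 (T : tapes4) (i j : tape_id) (a b : action) :
  i != j ->
  act_all (fun k => if k == i then a else if k == j then b else stay) T =
  put_tape (put_tape T i (act a (get_tape T i))) j (act b (get_tape T j)).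
Proof. by case: T i j => -[? ?] [? ?] [[] []] [[] []]. Qed.

(** The extra step is the one that leaves the loop. *)
Lemma iter_scan_right (q q' : label) (i : tape_id) (p : pred cell) (T : tapes4)
    (l x r : seq cell) :
  instr_at q = Scan i MoveRight p q' -> get_tape T i = at_cells l (x ++ r) ->
  all p x -> ~~ p (head None r) ->
  iter (size x).+1 step4 (q, T) = (q', put_tape T i (at_cells (catrev x l) r)).
Proof.
move=> qE; elim: x l T => [|y x IHx] l T Ti => [_|/andP[py px]] pr.
  by rewrite /= /step4 /delta qE /= Ti /= (negPf pr) act_all_stay -Ti put_get.
have step1 : step4 (q, T) = (q, put_tape T i (at_cells (y :: l) (x ++ r))).
  by rewrite /step4 /delta qE /= Ti /= py act_all1 Ti.
rewrite [size _]/= iterSr step1.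
by rewrite (IHx (y :: l)) // ?get_put // put_put.
Qed.

(** Describing the start as one move left from [r] covers empty [x], where the head is on [y] at
    once. The induction peels [x] from its right end, where the scan begins. *)
Lemma iter_scan_left (q q' : label) (i : tape_id) (p : pred cell) (T : tapes4)
    (l x r : seq cell) (y : cell) :
  instr_at q = Scan i MoveLeft p q' ->
  get_tape T i = move_head MoveLeft (at_cells (catrev x (y :: l)) r) ->
  r != [::] -> all p x -> ~~ p y ->
  iter (size x).+1 step4 (q, T) =
  (q', put_tape T i (at_cells l (y :: x ++ r))).
Proof.
move=> qE; elim/last_ind: x r T => [|x z IHx] r T Ti r0 => [_|px] py.
  rewrite [catrev _ _]/= move_left_cells // in Ti.
  by rewrite /= /step4 /delta qE /= Ti /= (negPf py) act_all_stay -Ti put_get.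
move: px; rewrite all_rcons => /andP[pz px].
have Ti' : get_tape T i = at_cells (catrev x (y :: l)) (z :: r).
  by rewrite Ti !catrevE rev_rcons move_left_cells.
have step1 : step4 (q, T) =
    (q, put_tape T i
          (move_head MoveLeft (at_cells (catrev x (y :: l)) (z :: r)))).
  by rewrite /step4 /delta qE /= Ti' /= pz act_all1 Ti'.
rewrite size_rcons iterSr step1.
by rewrite (IHx (z :: r)) // ?get_put // put_put cat_rcons.
Qed.

Lemma iter_transfer (q q' : label) (i j : tape_id) (p : pred cell) (T : tapes4)
    (l l' x r : seq cell) :
  instr_at q = Transfer i j p q' -> i != j ->
  get_tape T i = at_cells l (x ++ r) -> get_tape T j = at_cells l' [::] ->
  all p x -> all isSome x -> ~~ p (head None r) ->
  iter (size x).+1 step4 (q, T) =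
  (q', put_tape (put_tape T i (at_cells (catrev x l) r)) j
         (at_cells (catrev x l') [::])).
Proof.
move=> qE ij; elim: x l l' T => [|y x IHx] l l' T Ti Tj.
  move=> _ _ pr; rewrite /= /step4 /delta qE /= Ti /= (negPf pr).
  rewrite act_all_stay -Ti put_get.
  by rewrite -Tj put_get.
move=> /andP[py px] /andP[sy sx] pr.
have step1 : step4 (q, T) =
    (q, put_tape (put_tape T i (at_cells (y :: l) (x ++ r))) j
          (at_cells (y :: l') [::])).
  rewrite /step4 /delta qE /= Ti /= py act_all2 // Ti Tj.
  by case: (y) sy.
rewrite [size _]/= iterSr step1.
rewrite (IHx (y :: l) (y :: l')) //; last 2 first.
- by rewrite get_put_neq 1?eq_sym // get_put.
- by rewrite get_put.
rewrite (put_put_neq _ _ _ ij) put_put.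
by rewrite [in LHS]put_put_neq 1?eq_sym // put_put.
Qed.

Definition bits (a : seq bool) : seq cell := map (fun b => Some (Bit b)) a.

Lemma all_bits (a : seq bool) : all is_bit (bits a).
Proof. by rewrite all_map; apply/allP. Qed.

(** Both heads pass the longest common prefix, which serves as [a1] and as [b1]. After a mismatch it
    only matters that the heads are within or just behind the names, so that they can be rewound. *)
Lemma iter_compare (q same diff : label) (i j : tape_id) (T : tapes4)
    (a b : seq bool) (l l' r r' : seq cell) :
  instr_at q = Compare i j same diff -> i != j ->
  get_tape T i = at_cells l (bits a ++ r) ->
  get_tape T j = at_cells l' (bits b ++ r') ->
  ~~ is_bit (head None r) -> ~~ is_bit (head None r') ->
  exists a1 a2 b1 b2 : seq bool,
    [/\ a = a1 ++ a2, b = b1 ++ b2, (a == b) ==> (a2 == [::]) && (b2 == [::])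
      & iter (size a1).+1 step4 (q, T) =
        (if a == b then same else diff,
         put_tape (put_tape T i (at_cells (catrev (bits a1) l) (bits a2 ++ r)))
           j (at_cells (catrev (bits b1) l') (bits b2 ++ r')))].
Proof.
move=> qE ij; have ji : j != i by rewrite eq_sym.
elim: a b l l' T => [|x a IHa] b l l' T Ti Tj nr nr'.
  exists [::], [::], [::], b; split=> //=; first by case: b {Tj}.
  rewrite -Ti -Tj /step4 /delta qE /= Ti Tj /= (negPf nr) /= act_all_stay.
  rewrite -{1}Ti put_get -Tj put_get.
  by case: b {Tj} => [|? ?] /=; rewrite ?(negPf nr').
(* The default [x] of [head] would make an empty [b] look like a match, hence the separate test. *)
have [/andP[xb /eqP xy]|xb] := boolP ((b != [::]) && (head x b == x)).
  case: b Tj xb xy => //= y b Tj _ yx; rewrite {y}yx in Tj *.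
  have := IHa b (Some (Bit x) :: l) (Some (Bit x) :: l')
    (put_tape (put_tape T i (at_cells (Some (Bit x) :: l) (bits a ++ r)))
       j (at_cells (Some (Bit x) :: l') (bits b ++ r'))).
  rewrite get_put (get_put_neq _ _ ji) get_put.
  case=> // a1 [a2 [b1 [b2 [a12 b12 ab run]]]]; subst a b.
  exists (x :: a1), a2, (x :: b1), b2.
  have step1 : step4 (q, T) =
      (q, put_tape (put_tape T i
            (at_cells (Some (Bit x) :: l) (bits (a1 ++ a2) ++ r))) j
            (at_cells (Some (Bit x) :: l') (bits (b1 ++ b2) ++ r'))).
    by rewrite /step4 /delta qE /= Ti Tj /= eqxx act_all2 // Ti Tj.
  split=> //; first by rewrite eqseq_cons eqxx.
  apply: etrans (iterSr (size a1).+1 step4 (q, T)) _.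
  rewrite step1 run eqseq_cons eqxx.
  by rewrite (put_put_neq _ _ _ ij) put_put (put_put_neq _ _ _ ji) put_put.
have ab : (x :: a == b) = false.
  by case: b xb {Tj} => //= y b; rewrite eqseq_cons [x == y]eq_sym => /negPf->.
exists [::], (x :: a), [::], b; rewrite ab; split=> //=.
rewrite -Ti -Tj put_get /step4 /delta qE /= Ti Tj /=.
have -> : (Some (Bit x) == head None (bits b ++ r')) = false.
  case: b xb {Tj ab} => [_|y b] /=; last by apply: contraNF => /eqP[->].
  by apply: contraNF nr' => /eqP <-.
by rewrite act_all_stay -Tj put_get.
Qed.

Lemma move_right_cells (l r : seq cell) (x : cell) :
  move_head MoveRight (at_cells l (x :: r)) = at_cells (x :: l) r.
Proof. by []. Qed.

Lemma write_cells (l r : seq cell) (x : cell) :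
  write x (at_cells l r) = at_cells l (x :: behead r).
Proof. by []. Qed.

Lemma move_head_stay (t : tape insym) : move_head Stay t = t.
Proof. by []. Qed.

Definition tapeE := (move_right_cells, write_cells, move_head_stay).

Arguments at_cells : simpl never.
Arguments move_head : simpl never.
Arguments write : simpl never.
Arguments bits : simpl never.

(** * Counting instructions *)

Section Bounded.
Variable M : nat.

(** Every instruction takes at most [M.+1] steps as long as the words it runs
    over have length at most [M], so that it is enough to count instructions. *)
Definition decides (k : nat) (c : state4) (b : bool) : Prop :=
  exists2 n, n <= k * M.+1 & answer (iter n step4 c).1 = Some b.

Lemma decides_leq (k k' : nat) (c : state4) (b : bool) :
  k <= k' -> decides k c b -> decides k' c b.
Proof.
move=> kk' [n nk ans]; exists n => //; apply: leq_trans nk _.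
by rewrite leq_mul2r kk' orbT.
Qed.

Lemma decides_iter (k n : nat) (c c' : state4) (b : bool) :
  n <= M -> iter n.+1 step4 c = c' -> decides k c' b -> decides k.+1 c b.
Proof.
move=> nM <- [m mk ans]; exists (m + n.+1); last by rewrite iterD.
by rewrite mulSn addnC leq_add.
Qed.

Lemma decides_halt (k : nat) (q : label) (T : tapes4) (b : bool) :
  instr_at q = Halt b -> decides k (q, T) b.
Proof. by move=> qE; exists 0; rewrite //= /answer qE. Qed.

Lemma decides_do (k : nat) (q q' : label) (a : tape_id -> action) (T : tapes4)
    (b : bool) :
  instr_at q = Do a q' -> decides k (q', act_all a T) b ->
  decides k.+1 (q, T) b.
Proof.
by move=> qE; apply: (@decides_iter _ 0) => //=; rewrite /step4 /delta qE.
Qed.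

Lemma decides_branch (k : nat) (q : label) (f : (tape_id -> cell) -> label)
    (T : tapes4) (b : bool) :
  instr_at q = Branch f ->
  decides k (f (fun i => scanned (get_tape T i)), T) b -> decides k.+1 (q, T) b.
Proof.
move=> qE; apply: (@decides_iter _ 0) => //=.
by rewrite /step4 /delta qE /= act_all_stay.
Qed.

Lemma decides_scan_right (k : nat) (q q' : label) (i : tape_id) (p : pred cell)
    (T : tapes4) (l x r : seq cell) (b : bool) :
  instr_at q = Scan i MoveRight p q' -> get_tape T i = at_cells l (x ++ r) ->
  all p x -> ~~ p (head None r) -> size x <= M ->
  decides k (q', put_tape T i (at_cells (catrev x l) r)) b ->
  decides k.+1 (q, T) b.
Proof.
move=> qE Ti px pr xM; apply: decides_iter xM _.
exact: iter_scan_right qE Ti px pr.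
Qed.

Lemma decides_scan_left (k : nat) (q q' : label) (i : tape_id) (p : pred cell)
    (T : tapes4) (l x r : seq cell) (y : cell) (b : bool) :
  instr_at q = Scan i MoveLeft p q' ->
  get_tape T i = move_head MoveLeft (at_cells (catrev x (y :: l)) r) ->
  r != [::] -> all p x -> ~~ p y -> size x <= M ->
  decides k (q', put_tape T i (at_cells l (y :: x ++ r))) b ->
  decides k.+1 (q, T) b.
Proof.
move=> qE Ti r0 px py xM; apply: decides_iter xM _.
exact: iter_scan_left qE Ti r0 px py.
Qed.

Lemma decides_transfer (k : nat) (q q' : label) (i j : tape_id) (p : pred cell)
    (T : tapes4) (l l' x r : seq cell) (b : bool) :
  instr_at q = Transfer i j p q' -> i != j ->
  get_tape T i = at_cells l (x ++ r) -> get_tape T j = at_cells l' [::] ->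
  all p x -> all isSome x -> ~~ p (head None r) -> size x <= M ->
  decides k (q', put_tape (put_tape T i (at_cells (catrev x l) r)) j
                   (at_cells (catrev x l') [::])) b ->
  decides k.+1 (q, T) b.
Proof.
move=> qE ij Ti Tj px sx pr xM; apply: decides_iter xM _.
exact: iter_transfer qE ij Ti Tj px sx pr.
Qed.

Lemma decides_compare (k : nat) (q same diff : label) (i j : tape_id)
    (T : tapes4) (a b : seq bool) (l l' r r' : seq cell) (d : bool) :
  instr_at q = Compare i j same diff -> i != j ->
  get_tape T i = at_cells l (bits a ++ r) ->
  get_tape T j = at_cells l' (bits b ++ r') ->
  ~~ is_bit (head None r) -> ~~ is_bit (head None r') -> size a <= M ->
  (a = b -> decides k (same,
     put_tape (put_tape T i (at_cells (catrev (bits a) l) r)) j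
       (at_cells (catrev (bits a) l') r')) d) ->
  (forall a1 a2 b1 b2 : seq bool,
   a != b -> a = a1 ++ a2 -> b = b1 ++ b2 -> decides k (diff,
     put_tape (put_tape T i (at_cells (catrev (bits a1) l) (bits a2 ++ r))) j
       (at_cells (catrev (bits b1) l') (bits b2 ++ r'))) d) ->
  decides k.+1 (q, T) d.
Proof.
move=> qE ij Ti Tj nr nr' aM run_same run_diff.
have [a1 [a2 [b1 [b2 [a12 b12 ab run]]]]] := iter_compare qE ij Ti Tj nr nr'.
have a1M : size a1 <= M
  by apply: leq_trans aM; rewrite a12 size_cat leq_addr.
apply: decides_iter a1M run _.
have [eq_ab|neq_ab] := eqVneq a b; last exact: run_diff.
move: ab; rewrite eq_ab eqxx => /andP[/eqP a20 /eqP b20].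
have := run_same eq_ab; rewrite a12 a20 cats0.
congr (decides _ (_, put_tape _ _ (at_cells (catrev _ _) _)) _).
  by rewrite -(cats0 a1) -a20 -a12 eq_ab b12 b20 cats0.
by rewrite b20.
Qed.

(** * Searching the environments for a binder *)

(** The cells are listed leftwards from the top, so each name is reversed and its mark comes after
    it. *)
Fixpoint stack (E : seq (seq bool)) : seq cell :=
  if E is c :: E' then catrev (bits c) (Some BarMark :: stack E')
  else [:: Some Separator].

(** Every level has a mark and the bottom a separator. This bounds the number of levels of a search
    by the length of the environment. *)
Lemma size_stack (E : seq (seq bool)) : size E < size (stack E).
Proof.
elim: E => //= c E IHE.
by rewrite catrevE size_cat /= addnS ltnS (leq_trans IHE) ?leq_addl.
Qed.

(** The non-bit stops a comparison at the end of the name; the stored cell lets the head move back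
    left by [move_left_cells]. *)
Definition name_end (r : seq cell) : bool :=
  (r != [::]) && ~~ is_bit (head None r).

Lemma bits_cat (a b : seq bool) (r : seq cell) :
  bits (a ++ b) ++ r = bits a ++ bits b ++ r.
Proof. by rewrite /bits map_cat catA. Qed.

Lemma size_bits (a : seq bool) : size (bits a) = size a.
Proof. exact: size_map. Qed.

Lemma all_isSome_bits (a : seq bool) : all isSome (bits a).
Proof. by rewrite all_map; apply/allP. Qed.

Lemma size_bits_prefix (a b : seq bool) :
  size (bits (a ++ b)) <= M -> size (bits a) <= M.
Proof. by apply: leq_trans; rewrite !size_bits size_cat leq_addr. Qed.

Lemma cat_neq0 (x r : seq cell) : r != [::] -> x ++ r != [::].
Proof. by case: x. Qed.

(** The heads of the words are on the marks in front of the names [a] and [b];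
    the environments are read from the top. *)
Lemma decides_search (k : nat) (E : seq (seq bool * seq bool)) (a b : seq bool)
    (lv lw rv rw xv xw : seq cell) (d : bool) :
  name_end rv -> name_end rw ->
  name_end (xv ++ [:: None]) -> name_end (xw ++ [:: None]) ->
  all isSome xv -> all isSome xw ->
  size (stack (unzip1 E)) <= M -> size (stack (unzip2 E)) <= M ->
  size a <= M -> size b <= M ->
  (same_binder E a b -> forall lv' lw' xv' xw' : seq cell,
     all isSome xv' -> all isSome xw' ->
     catrev xv' lv' = catrev xv (stack (unzip1 E)) ->
     catrev xw' lw' = catrev xw (stack (unzip2 E)) ->
     decides k (TopV,
       ((at_cells (catrev (bits b) (Some PlainMark :: lw)) rw,
         at_cells (catrev (bits a) (Some PlainMark :: lv)) rv),
        (at_cells lw' (xw' ++ [:: None]),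
         at_cells lv' (xv' ++ [:: None])))) d) ->
  (same_binder E a b = false -> d = false) ->
  decides (k + 12 * (size E).+1) (PopMark,
    ((at_cells lw (Some PlainMark :: bits b ++ rw),
      at_cells lv (Some PlainMark :: bits a ++ rv)),
     (at_cells (stack (unzip2 E)) (xw ++ [:: None]),
      at_cells (stack (unzip1 E)) (xv ++ [:: None])))) d.
Proof.
move=> /andP[rv0 nrv] /andP[rw0 nrw] + + + + + + aM bM found lost.
(* Levels already passed are added to [xv] and [xw], which therefore vary in the induction. *)
elim: E xv xw found lost => [|[c e] E IHE] xv xw found lost
  /andP[xv0 nxv] /andP[xw0 nxw] sxv sxw EvM EwM; rewrite mulnS addnCA addnC.
  (* At the bottom six instructions suffice: [PopMark] to [AtMark], [EnterFree] and
     [CompareFree]. *)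
  rewrite muln0 addn0; apply: (@decides_leq (k + 6)).
    by rewrite leq_add2l.
  rewrite addnC !addSn add0n.
  apply: decides_do => //=; rewrite ?tapeE.
  apply: (decides_scan_left (i := env_v) (x := [::])) => //=.
  apply: (decides_scan_left (i := env_w) (x := [::])) => //=.
  apply: decides_branch => //=.
  apply: decides_do => //=; rewrite ?tapeE.
  apply: (decides_compare (i := word_v) (j := word_w)) => //=.
    move=> eq_ab; rewrite -eq_ab /= eqxx in found.
    exact: (found isT [::] [::] (Some Separator :: xv) (Some Separator :: xw)).
  move=> a1 a2 b1 b2 neq_ab _ _; rewrite lost /= ?(negPf neq_ab) //.
  exact: decides_halt.
(* A level that matches neither name takes twelve instructions: four to find its marks, three to
   enter and compare, five to rewind. *)
apply: decides_leq (_ : 12 + (k + 12 * (size E).+1) <= _) _.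
  by rewrite addnC.
rewrite !addSn add0n.
have cM : size (bits c) <= M.
  by apply: leq_trans EvM; rewrite /= catrevE size_cat size_rev leq_addr.
have eM : size (bits e) <= M.
  by apply: leq_trans EwM; rewrite /= catrevE size_cat size_rev leq_addr.
have EvM' : size (stack (unzip1 E)) <= M.
  by apply: leq_trans EvM; rewrite /= catrevE size_cat /= addnS leqW ?leq_addl.
have EwM' : size (stack (unzip2 E)) <= M.
  by apply: leq_trans EwM; rewrite /= catrevE size_cat /= addnS leqW ?leq_addl.
apply: decides_do => //=; rewrite ?tapeE.
apply: (decides_scan_left (i := env_v) (x := bits c)) => //=.
  exact: all_bits.
apply: (decides_scan_left (i := env_w) (x := bits e)) => //=.
  exact: all_bits.
apply: decides_branch => //=.
apply: decides_do => //=; rewrite ?tapeE.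
apply: (decides_compare (i := word_v) (j := env_v)) => //=
  [ac|a1 a2 c1 c2 ac a12 c12].
  apply: (decides_compare (i := word_w) (j := env_w)) => //=
    [be|b1 b2 e1 e2 be b12 e12].
    rewrite -ac -be /= !eqxx in found *.
    apply: (@decides_leq k); first by lia.
    exact: (found isT (catrev (bits a) (Some BarMark :: stack (unzip1 E)))
       (catrev (bits b) (Some BarMark :: stack (unzip2 E))) xv xw).
  rewrite lost; first exact: decides_halt.
  by rewrite /= ac eqxx [e == b]eq_sym (negPf be).
apply: (decides_compare (i := word_w) (j := env_w)) => //=
    [be|b1 b2 e1 e2 be b12 e12].
  rewrite lost; first exact: decides_halt.
  by rewrite /= be eqxx [c == a]eq_sym (negPf ac).
apply: decides_do => //=; rewrite ?tapeE.
apply: (decides_scan_left (i := word_w) (x := bits b1)) => //=.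
- exact: cat_neq0.
- exact: all_bits.
- by apply: (@size_bits_prefix _ b2); rewrite -b12 size_bits.
apply: (decides_scan_left (i := word_v) (x := bits a1)) => //=.
- exact: cat_neq0.
- exact: all_bits.
- by apply: (@size_bits_prefix _ a2); rewrite -a12 size_bits.
apply: (decides_scan_left (i := env_v) (x := bits c1)) => //=.
- exact: cat_neq0.
- exact: all_bits.
- by apply: (@size_bits_prefix _ c2); rewrite -c12.
apply: (decides_scan_left (i := env_w) (x := bits e1)) => //=.
- exact: cat_neq0.
- exact: all_bits.
- by apply: (@size_bits_prefix _ e2); rewrite -e12.
(* All heads are back on marks. The rejoined names [c] and [e], with their marks, now extend [xv]
   and [xw]. *)
rewrite -!bits_cat -a12 -b12 -c12 -e12.
have := IHE (Some BarMark :: bits c ++ xv) (Some BarMark :: bits e ++ xw).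
have sb : same_binder ((c, e) :: E) a b = same_binder E a b.
  by rewrite /= [c == a]eq_sym [e == b]eq_sym (negPf ac) (negPf be).
rewrite /= -!catA; apply=> //=; try by rewrite all_cat all_isSome_bits.
- move=> ab lv' lw' xv' xw' sv sw; rewrite !catrev_catl.
  by apply: found; rewrite ?sb.
- by move=> ab; apply: lost; rewrite sb.
Qed.

(** * The main loop and the set-up phase *)

Definition cells (v : barstring (seq bool)) : seq cell :=
  map some (enc_barstring id v).

Lemma cells_Plain (a : seq bool) (v : barstring (seq bool)) :
  cells (Plain a :: v) = Some PlainMark :: bits a ++ cells v.
Proof. by rewrite /cells /enc_barstring /= map_cat -map_comp. Qed.

Lemma cells_Bar (a : seq bool) (v : barstring (seq bool)) :
  cells (Bar a :: v) = Some BarMark :: bits a ++ cells v.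
Proof. by rewrite /cells /enc_barstring /= map_cat -map_comp. Qed.

Lemma cells_end (v : barstring (seq bool)) (r : seq cell) :
  name_end (cells v ++ Some Separator :: r).
Proof. by case: v => [|[a|a] v]; rewrite ?cells_Plain ?cells_Bar. Qed.

(** A bar letter moves its cells from a word to an environment and a plain letter only shortens the
    word, so the sums never grow. Each letter is granted [12 * M.+1] instructions for a search and 4
    more, as used by [NextLetter], [PushMark], [PushV], [PushW]; one further round covers the
    end. *)
Lemma decides_main (v w : barstring (seq bool)) (E : seq (seq bool * seq bool))
    (lv lw rv rw : seq cell) :
  size (stack (unzip1 E)) + size (cells v) <= M ->
  size (stack (unzip2 E)) + size (cells w) <= M ->
  decides ((size v).+1 * (12 * M.+1 + 4)) (NextLetter,
    ((at_cells lw (cells w ++ Some Separator :: rw),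
      at_cells lv (cells v ++ Some Separator :: rv)),
     (at_cells (stack (unzip2 E)) [::], at_cells (stack (unzip1 E)) [::])))
    (alpha_check E v w).
Proof.
elim: v w E lv lw => [|x v IHv] w E lv lw EvM EwM; rewrite mulSn.
  apply: (@decides_leq 1); first by lia.
  apply: decides_branch => //.
  case: w EwM => [|[b|b] w] _ /=; rewrite ?cells_Plain ?cells_Bar;
  exact: decides_halt.
set K := size _ * _; apply: (@decides_leq (K + 12 * M.+1 + 3).+1); first by lia.
apply: decides_branch => //.
case: x EvM @K => a EvM K; case: w EwM => [|[b|b] w] EwM;
  rewrite ?cells_Plain ?cells_Bar; try exact: decides_halt.
  rewrite cells_Plain /= size_cat size_bits in EvM.
  rewrite cells_Plain /= size_cat size_bits in EwM.
  have EM := size_stack (unzip1 E); rewrite size_map in EM.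
  apply: (@decides_leq (K.+2 + 12 * (size E).+1)); first by lia.
  rewrite /= -!catA.
  (* The search starts at the tops: [at_cells l [::]] and [at_cells l [:: None]] are convertible. *)
  apply: (@decides_search _ _ _ _ _ _ _ _ [::] [::]) => //.
  - exact: cells_end.
  - exact: cells_end.
  - by lia.
  - by lia.
  - by lia.
  - by lia.
  - move=> ab lv' lw' xv' xw' sv sw lvE lwE; rewrite ab.
    have xvM : size xv' <= M.
      by have := congr1 size lvE; rewrite catrevE size_cat size_rev /=; lia.
    have xwM : size xw' <= M.
      by have := congr1 size lwE; rewrite catrevE size_cat size_rev /=; lia.
    apply: (decides_scan_right (i := env_v) (x := xv')) => //=.
    apply: (decides_scan_right (i := env_w) (x := xw')) => //=.
    rewrite lvE lwE; apply: IHv; lia.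
  - by move=> ->.
rewrite cells_Bar /= size_cat size_bits in EvM.
rewrite cells_Bar /= size_cat size_bits in EwM.
have [_ nv] := andP (cells_end v rv); have [_ nw] := andP (cells_end w rw).
apply: (@decides_leq (K + 12 * M.+1).+3); first by lia.
rewrite /= -!catA; apply: decides_do => //=; rewrite ?tapeE.
apply: (decides_transfer (i := word_v) (j := env_v) (x := bits a)) => //=.
- exact: all_bits.
- exact: all_isSome_bits.
- by rewrite size_bits; lia.
apply: (decides_transfer (i := word_w) (j := env_w) (x := bits b)) => //=.
- exact: all_bits.
- exact: all_isSome_bits.
- by rewrite size_bits; lia.
apply: (@decides_leq K); first by lia.
by apply: (IHv w ((a, b) :: E));
  rewrite /= catrevE size_cat size_rev size_bits /=; lia.
Qed.

(** The 8 instructions are those from [Init] to [Enter]. Strictness leaves room for the bottom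
    separator of an environment. *)
Lemma decides_init (v w : barstring (seq bool)) :
  size (cells v) + size (cells w) < M ->
  decides ((size v).+1 * (12 * M.+1 + 4) + 8)
    (Init, ((at_cells [::] (cells v ++ Some Separator :: cells w),
             at_cells [::] [::]), (at_cells [::] [::], at_cells [::] [::])))
    (alpha_check [::] v w).
Proof.
move=> vwM.
have sv : all isSome (cells v) by rewrite all_map; apply/allP.
have sw : all isSome (cells w) by rewrite all_map; apply/allP.
have no_sep x : all (predC is_separator) (cells x).
  elim: x => //= -[a|a] x IHx;
    rewrite ?cells_Plain ?cells_Bar /= all_cat IHx andbT;
  by rewrite all_map; apply/allP.
rewrite addnC !addSn add0n; apply: decides_do => //=; rewrite ?tapeE.
apply: (decides_transfer (i := word_w) (j := word_v) (x := cells v)) => //=.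
  by lia.
apply: decides_do => //=; rewrite ?tapeE.
apply: (decides_scan_right (i := word_w) (x := cells w) (r := [::])) => //=.
- by rewrite cats0.
- by lia.
apply: decides_do => //=; rewrite ?tapeE.
apply: (decides_scan_left (i := word_w) (x := cells w)
          (r := [:: Some Separator]) (y := Some Separator)) => //=.
  by lia.
apply: (decides_scan_left (i := word_v) (x := cells v)
          (r := [:: Some Separator]) (y := Some Separator)) => //=.
  by lia.
apply: decides_do => //=; rewrite ?tapeE.
by apply: (decides_main (E := [::])) => /=; lia.
Qed.

End Bounded.

(** * Simulation by a Turing machine *)

(** The two binary digits of the index; index 0, the input tape, is [word_w]. *)
Definition id_of (i : 'I_4) : tape_id := (1 < i, odd i).

Definition ord_of (i : tape_id) : 'I_4 := inord (i.1.*2 + i.2).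

Lemma ord_ofK : cancel ord_of id_of.
Proof.
by move=> [e s]; rewrite /id_of /ord_of inordK; case: e; case: s.
Qed.

(** Only input symbols are ever written, so the work alphabet is empty. *)
Definition machine_cell : Type := option (insym + void).

Definition embed (s : cell) : machine_cell := omap inl s.

Definition project (s : machine_cell) : cell :=
  if s is Some (inl x) then Some x else None.

Lemma embedK : cancel embed project.
Proof. by case. Qed.

Definition embed_tape (t : tape insym) : tape (insym + void) :=
  Tape (map embed (left_part t)) (embed (scanned t)) (map embed (right_part t)).

Lemma embed_tape_of (s : seq insym) :
  embed_tape (tape_of s) = tape_of (map inl s).
Proof. by case: s => [|x s] //; rewrite /embed_tape /tape_of /= -!map_comp. Qed.

Lemma embed_act (a : action) (t : tape insym) :
  embed_tape (act a t) =
  move_head a.2 (write (if a.1 is Some s then Some (inl s)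
                        else embed (scanned t)) (embed_tape t)).
Proof. by case: a t => [[x|] []] [[|y l] s [|z r]]. Qed.

Definition alpha_trans (q : label) (s : {ffun 'I_4 -> machine_cell}) :
    label * {ffun 'I_4 -> machine_cell * move} :=
  let r := delta q (fun i => project (s (ord_of i))) in
  (r.1, [ffun k => let a := r.2 (id_of k) in
                   (if a.1 is Some x then Some (inl x) else s k, a.2)]).

Definition alpha_machine : machine insym :=
  @Machine insym label void 3 Init answer alpha_trans.

(** Machine and program read the cells through functions that agree only pointwise. A [Branch] may
    hold any function of them, so the labels are inspected one by one. *)
Lemma eq_delta (q : label) (s s' : tape_id -> cell) :
  s =1 s' -> delta q s = delta q s'.
Proof. by move=> ss'; case: q; rewrite /delta /= ?ss'. Qed.

Lemma get_act_all (a : tape_id -> action) (T : tapes4) (i : tape_id) :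
  get_tape (act_all a T) i = act (a i) (get_tape T i).
Proof. by case: T i => -[? ?] [? ?] [[] []]. Qed.

Definition simulates (k : config alpha_machine) (c : state4) : Prop :=
  cur_state k = c.1 /\
  forall i, tapes k i = embed_tape (get_tape c.2 (id_of i)).

Lemma simulates_step (k : config alpha_machine) (c : state4) :
  simulates k c -> simulates (step k) (step4 c).
Proof.
case: k c => q t [q' T] [/= -> {q}] tT; rewrite /step /=.
case qE: (answer q') => [b|].
  (* A halted machine is frozen by [step], and [Halt] makes the program stay put as well. *)
  move: qE; rewrite /answer /step4 /delta /=.
  by case: (instr_at q') => // b' _; rewrite /= act_all_stay.
set r := delta _ _.
have rE : r = delta q' (fun i => scanned (get_tape T i)).
  by apply: eq_delta => i; rewrite ffunE tT ord_ofK embedK.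
split=> [|i]; first by rewrite /= -/r rE.
by rewrite /= -/r rE ffunE /= get_act_all embed_act ffunE tT.
Qed.

Lemma simulates_init (s : seq insym) :
  simulates (init alpha_machine s)
    (Init, ((at_cells [::] (map some s), at_cells [::] [::]),
            (at_cells [::] [::], at_cells [::] [::]))).
Proof.
split=> // i; rewrite /= -embed_tape_of -(embed_tape_of [::]).
by case: i => -[|[|[|[|]]]].
Qed.

(** * Encoded inputs and the polynomial bound *)

Lemma enc_barstring_map (A : Type) (code : A -> seq bool) (v : barstring A) :
  enc_barstring id (map (map_letter code) v) = enc_barstring code v.
Proof.
by rewrite /enc_barstring -map_comp; congr flatten; apply: eq_map => -[].
Qed.

Lemma size_enc_barstring (A : Type) (code : A -> seq bool) (v : barstring A) :
  size v <= size (enc_barstring code v).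
Proof.
by elim: v => //= -[a|a] v IHv;
  rewrite /= size_cat ltnS (leq_trans IHv) ?leq_addl.
Qed.

Theorem corollary4p4 (A : countType)
    (A_infinite : forall s : seq A, exists a : A, a \notin s)
    (code : A -> seq bool) (code_inj : injective code) :
  polytime_decidable (enc_pair code)
    (fun vw : barstring A * barstring A => alpha_eq vw.1 vw.2).
Proof.
(* With ['X] the input length, there are at most ['X + 1] rounds of [12 * ('X + 1) + 4] instructions
   and 8 for the set-up, each of at most ['X + 1] steps. *)
exists alpha_machine,
  ((('X + 1) * (12%N%:P * ('X + 1) + 4%N%:P) + 8%N%:P) * ('X + 1))%R.
move=> [v w] /=; set s := enc_pair code (v, w).
pose v' := map (map_letter code) v; pose w' := map (map_letter code) w.
have sE : map some s = cells v' ++ Some Separator :: cells w'.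
  by rewrite /s /enc_pair map_cat /= /cells !enc_barstring_map.
(* The input length serves as [M]; the separator between the words makes the inequality strict. *)
have lt_s : size (cells v') + size (cells w') < size s.
  by rewrite -[size s](size_map some) sE size_cat /= addnS.
have vs : size v' <= size s.
  rewrite size_map (leq_trans (size_enc_barstring code v)) //.
  by rewrite size_cat leq_addr.
have [n nM ans] := decides_init lt_s.
exists n, (alpha_check [::] v' w'); split.
- rewrite !hornerE.
  apply: leq_trans nM _; rewrite -[(size s).+1]addn1.
  by rewrite leq_mul2r leq_add2r leq_mul2r; apply/or3P/Or33;
    rewrite [X in _ < X]addn1.
- rewrite /answer_after; rewrite -sE in ans.
  have: simulates (iter n (@step _ alpha_machine) (init alpha_machine s))
     (iter n step4 (Init, ((at_cells [::] (map some s), at_cells [::] [::]),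
            (at_cells [::] [::], at_cells [::] [::])))).
    by elim: n {nM ans} => [|n IHn];
      [exact: simulates_init | exact: simulates_step].
  by case=> /= -> _.
(* Injectivity of [code] carries the check back from codes to names, where it amounts to equality of
   de Bruijn forms. *)
by rewrite (@alpha_check_map _ _ code [::]) // alpha_checkP /=
  alpha_eq_debruijn.
Qed.
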